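(* Suppose that a polygon with $2k$ sides ($k\ge 2$) is inscribed in an irreducible conic in $\mathbb{P}^2$. Working around the perimeter of the polygon, color the edges alternately red and blue. Extend the edges to lines, and consider the $k^2-2k$ (distinct) points of intersection of the red lines with the blue lines, omitting the original $2k$ vertices of the polygon. If $k-1$ of these $k^2-2k$ points lie on a line (called green), then another of these $k^2-2k$ points lies on the green line as well.
   Context: $\mathbb{P}^2$ denotes the complex projective plane. A polygon with $2k$ sides inscribed in a conic is given by $2k$ distinct points $v_1,\dots,v_{2k}$ (the vertices) on the conic, in cyclic order; its edges are $v_iv_{i+1}$ (indices modulo $2k$), and the edge $v_iv_{i+1}$ is extended to the line through $v_i$ and $v_{i+1}$. There are $k$ red lines and $k$ blue lines, and each vertex is the intersection of one red line and one blue line. *)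

(* Defs.v *)
From HB Require Import structures.
From mathcomp Require Import all_boot all_order all_algebra.
From mathcomp Require Import mpoly.
From mathcomp Require Import reals complex.

Set Implicit Arguments.
Unset Strict Implicit.
Unset Printing Implicit Defensive.

Import GRing.Theory.
Local Open Scope ring_scope.

(* Points and lines of the projective plane over F are the subspaces of F^3 of
   dimension 1 and 2, so that Leibniz equality is equality in P^2. *)
Definition point (F : fieldType) := {U : {vspace 'rV[F]_3} | \dim U == 1%N}.
Definition line (F : fieldType) := {U : {vspace 'rV[F]_3} | \dim U == 2%N}.

Definition incident (F : fieldType) (P : point F) (U : {vspace 'rV[F]_3}) : bool :=
  (val P <= U)%VS.

Definition irreducible_mpoly (F : fieldType) (n : nat) (q : {mpoly F[n]}) : Prop :=
  [/\ q != 0, q \isn't a GRing.unit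
    & forall a b : {mpoly F[n]}, q = a * b ->
        a \is a GRing.unit \/ b \is a GRing.unit].

Definition irreducible_conic (F : fieldType) (q : {mpoly F[3]}) : Prop :=
  q \is 2.-homog /\ irreducible_mpoly q.

Definition on_conic (F : fieldType) (q : {mpoly F[3]}) (P : point F) : Prop :=
  forall x : 'rV[F]_3, x \in val P -> q.@[fun i => x 0 i] = 0.

Definition inscribed_polygon (F : fieldType) (n : nat)
    (q : {mpoly F[3]}) (v : 'I_n -> point F) : Prop :=
  injective v /\ forall i, on_conic q (v i).

(* ordS is the cyclic successor on 'I_n. The span below has dimension 2, i.e.
   is a line, as soon as v i and v (ordS i) are distinct. *)
Definition edge_line (F : fieldType) (n : nat) (v : 'I_n -> point F) (i : 'I_n)
    : {vspace 'rV[F]_3} :=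
  (val (v i) + val (v (ordS i)))%VS.

Definition red (n : nat) (i : 'I_n) : bool := ~~ odd i.
Definition blue (n : nat) (i : 'I_n) : bool := odd i.

Definition red_blue_point (F : fieldType) (n : nat) (v : 'I_n -> point F)
    (P : point F) : Prop :=
  (exists i j : 'I_n, [/\ red i, blue j,
     incident P (edge_line v i) & incident P (edge_line v j)])
  /\ forall m : 'I_n, P <> v m.

(* Main.v *)
Require Import Defs.
From mathcomp Require Import all_boot all_order all_algebra.
From mathcomp Require Import mpoly ring zify.
From mathcomp Require Import reals complex.

Set Implicit Arguments.
Unset Strict Implicit.
Unset Printing Implicit Defensive.

Import GRing.Theory Num.Theory.
Local Open Scope ring_scope.

(** Let R and B be the products of the linear forms of the red and of the blue
    lines, both of degree k, and let Q be the quadratic form of the conic.  The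
    whole proof rests on one identity
        B = c R + Q C,     c a constant, C a form of degree k - 2
    (red_blue_pencil).  On the conic R and B have the same 2k zeros, so some
    combination of them vanishes on all of it; here the identity is obtained
    more directly, by induction on the polygon.  The pencil of conics through
    four points of the conic contains the conic itself and both pairs of
    opposite sides of the quadrilateral (quadrilateral_pencil); replacing the
    closing edge of a polygon by three edges multiplies the identity by an
    instance of this case.

    Irreducibility is used only in the following form: the conic contains no
    line, that is, the polar form does not vanish at two independent isotropic
    vectors (irreducible_conic_polar).  So a line meets the conic in at most two
    points, and an edge line meets it in its two vertices only.

    The theorem follows from two facts on C.
    - C vanishes at every red-blue intersection other than a vertex
      (pencil_red_blue): R and B vanish there and Q does not.
    - C vanishes at no vertex (pencil_off_vertices): along the red line of a
      vertex x the identity is B = Q C, where B has a simple zero at x because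
      only one blue line passes through x, and Q accounts for that zero.
    As C has degree k - 2 and vanishes at k - 1 points of the green line, it
    vanishes on the whole green line (homform_vanish_on_line), which therefore
    contains no vertex.  There B = c R, so wherever a red line meets the green
    line some blue line passes too, and the point is one of the given
    intersections.  If all these points were among the k - 1 chosen ones, two of
    the k red lines would meet the green line at the same point.  This point
    would then be the intersection of two red-blue pairs, and the number of
    distinct intersections would be less than k^2 - 2k (red_blue_simple). *)

(** * Determinants and quadratic forms in three variables *)

Section Plane.
Variable A : comNzRingType.
Implicit Types (x y z : 'rV[A]_3) (M : 'M[A]_3).

Definition det3 x y z : A :=
  x 0 0 * (y 0 1 * z 0 2 - y 0 2 * z 0 1)
  - x 0 1 * (y 0 0 * z 0 2 - y 0 2 * z 0 0)
  + x 0 2 * (y 0 0 * z 0 1 - y 0 1 * z 0 0).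

Definition qform M x : A := \sum_i \sum_j M i j * (x 0 i * x 0 j).

Definition polar M x y : A :=
  \sum_i \sum_j M i j * (x 0 i * y 0 j + y 0 i * x 0 j).

Lemma ord3P (i : 'I_3) : [\/ i = 0, i = 1 | i = 2].
Proof.
by case: i => [[|[|[|//]]] lti]; [constructor 1 | constructor 2 | constructor 3];
   apply: val_inj.
Qed.

(** Cramer's rule for the basis x, y, z, without division. *)
Lemma cramer3 x y z w :
  det3 x y z *: w = det3 w y z *: x + det3 x w z *: y + det3 x y w *: z.
Proof.
by apply/rowP => i; rewrite !mxE /det3; case: (ord3P i) => ->; ring.
Qed.

Lemma qform3 M a b c x y z :
  qform M (a *: x + b *: y + c *: z) =
  a ^+ 2 * qform M x + b ^+ 2 * qform M y + c ^+ 2 * qform M z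
  + a * b * polar M x y + a * c * polar M x z + b * c * polar M y z.
Proof. by rewrite /qform /polar !big_ord_recl !big_ord0 !mxE; ring. Qed.

Lemma det3_rot x y z : det3 y z x = det3 x y z.
Proof. by rewrite /det3; ring. Qed.

Lemma det3_swap x y z : det3 y x z = - det3 x y z.
Proof. by rewrite /det3; ring. Qed.

Lemma det3_combl x y a b : det3 x y (a *: x + b *: y) = 0.
Proof. by rewrite /det3 !mxE; ring. Qed.

Lemma det3_line x y z w t : det3 x y (z + t *: w) = det3 x y z + t * det3 x y w.
Proof. by rewrite /det3 !mxE; ring. Qed.

Lemma det3Z x y t z : det3 x y (t *: z) = t * det3 x y z.
Proof. by rewrite /det3 !mxE; ring. Qed.

Lemma qform_line M x y t :
  qform M (x + t *: y) = qform M x + t * polar M x y + t ^+ 2 * qform M y.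
Proof. by rewrite /qform /polar !big_ord_recl !big_ord0 !mxE; ring. Qed.

Lemma qform2 M a b x y :
  qform M (a *: x + b *: y) =
  a ^+ 2 * qform M x + b ^+ 2 * qform M y + a * b * polar M x y.
Proof. by rewrite /qform /polar !big_ord_recl !big_ord0 !mxE; ring. Qed.

Lemma qformZ M a x : qform M (a *: x) = a ^+ 2 * qform M x.
Proof. by rewrite /qform !big_ord_recl !big_ord0 !mxE; ring. Qed.

(** If qform M vanishes on the plane spanned by x and y, then, in the coordinates of the
    basis x, y, z, every term contains the third coordinate det3 x y w.  No
    division occurs, so w may be the vector of the indeterminates. *)
Lemma qform_factor M x y z w :
  qform M x = 0 -> qform M y = 0 -> polar M x y = 0 ->
  det3 x y z ^+ 2 * qform M w = det3 x y w *
    (det3 w y z * polar M x z + det3 x w z * polar M y z + det3 x y w * qform M z).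
Proof. by move=> qx qy pxy; rewrite -qformZ cramer3 qform3 qx qy pxy; ring. Qed.

End Plane.

Section Independence.
Variable F : fieldType.
Implicit Types x y z : 'rV[F]_3.

Lemma free2P x y : reflect (x != 0 /\ forall t, y <> t *: x) (free [:: y; x]).
Proof.
rewrite free_cons seq1_free span_seq1.
apply: (iffP andP) => [[yx x0]|[x0 yx]]; split => //.
  by move=> t yE; case/negP: yx; apply/vlineP; exists t.
by apply/negP => /vlineP[t /yx].
Qed.

Lemma free2C x y : free [:: x; y] = free [:: y; x].
Proof. by apply: perm_free; rewrite (perm_catC [:: x] [:: y]). Qed.

(** The minors of the two rows are the values of det3 x y at the standard basis;
    if they all vanish, then x is a multiple of y. *)
Lemma free2_det3 x y : free [:: x; y] -> exists z, det3 x y z != 0.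
Proof.
move=> /free2P[y0 xy].
pose d i : F := det3 x y (delta_mx 0 i).
have [/forallP d0|/forallPn[i di]] := boolP [forall i, d i == 0]; last first.
  by exists (delta_mx 0 i).
have {}d0 i : d i = 0 by apply/eqP.
have m0 : x 0 1 * y 0 2 = x 0 2 * y 0 1.
  by apply/eqP; rewrite -subr_eq0 -(d0 0) /d /det3 !mxE /=; apply/eqP; ring.
have m1 : x 0 0 * y 0 2 = x 0 2 * y 0 0.
  apply/eqP; rewrite -subr_eq0 -[X in _ == X]oppr0 -(d0 1) /d /det3 !mxE /=.
  by apply/eqP; ring.
have m2 : x 0 0 * y 0 1 = x 0 1 * y 0 0.
  by apply/eqP; rewrite -subr_eq0 -(d0 2) /d /det3 !mxE /=; apply/eqP; ring.
have [/forallP y00|/forallPn[i yi]] := boolP [forall i, y 0 i == 0].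
  by case/eqP: y0; apply/rowP => i; rewrite mxE; apply/eqP.
case: (xy (x 0 i / y 0 i)); apply/rowP => j; rewrite mxE.
apply: (mulIf yi); rewrite mulrAC divfK //.
by move: yi; case: (ord3P i) => ->; case: (ord3P j) => -> _;
   rewrite ?m0 ?m1 ?m2 // mulrC.
Qed.

Lemma det3_eq0P x y z : free [:: x; y] ->
  reflect (exists a b, z = a *: x + b *: y) (det3 x y z == 0).
Proof.
move=> fxy; apply: (iffP eqP) => [xyz0|[a [b ->]]]; last exact: det3_combl.
have [w w0] := free2_det3 fxy.
have := cramer3 x y w z; rewrite xyz0 scale0r addr0 => zE.
exists (det3 z y w / det3 x y w), (det3 x z w / det3 x y w).
by apply: (scalerI w0); rewrite zE scalerDr !scalerA !(mulrC (det3 x y w)) !divfK.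
Qed.

Lemma det3_mem x y z : free [:: x; y] ->
  (det3 x y z == 0) = (z \in (<[x]> + <[y]>)%VS).
Proof.
move=> fxy; apply/(det3_eq0P _ fxy)/memv_addP.
  by case=> a [b ->]; exists (a *: x); rewrite ?memvZ ?memv_line //;
     exists (b *: y); rewrite ?memvZ ?memv_line.
by case=> _ /vlineP[a ->] [_ /vlineP[b ->]] ->; exists a, b.
Qed.

End Independence.

(** * Four points of a conic without lines *)

Section Conic.
Variables (F : fieldType) (M : 'M[F]_3).
Hypothesis M_nodegen : forall x y, free [:: x; y] ->
  qform M x = 0 -> qform M y = 0 -> polar M x y != 0.

Lemma conic_noncollinear x y z :
  qform M x = 0 -> qform M y = 0 -> qform M z = 0 ->
  free [:: x; y] -> free [:: x; z] -> free [:: y; z] -> det3 x y z != 0.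
Proof.
move=> qx qy qz fxy fxz fyz; apply/negP => /(det3_eq0P _ fxy)[a [b zE]].
have := qz; rewrite zE qform2 qx qy !mulr0 !add0r => /eqP.
rewrite mulf_eq0 (negPf (M_nodegen _ _ _)) // orbF mulf_eq0 => /orP[]/eqP e0.
  move: fyz; rewrite free2C => /free2P[_ /(_ b)[]].
  by rewrite zE e0 scale0r add0r.
move: fxz; rewrite free2C => /free2P[_ /(_ a)[]].
by rewrite zE e0 scale0r addr0.
Qed.

Lemma conic_secant x y z :
  qform M x = 0 -> qform M y = 0 -> free [:: x; y] -> qform M z = 0 ->
  det3 x y z = 0 -> z \in <[x]>%VS \/ z \in <[y]>%VS.
Proof.
move=> qx qy fxy qz /eqP/(det3_eq0P _ fxy)[a [b zE]].
have := qz; rewrite zE qform2 qx qy !mulr0 !add0r => /eqP.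
rewrite mulf_eq0 (negPf (M_nodegen _ _ _)) // orbF mulf_eq0 => /orP[]/eqP ->.
  by right; rewrite scale0r add0r memvZ ?memv_line.
by left; rewrite scale0r addr0 memvZ ?memv_line.
Qed.

(** The three conics involved pass through p1, p2, p3 and p4, and the conics
    through four points, no three of them collinear, form a pencil.  In the basis
    p1, p2, p3 the conics through these three points have only the mixed terms, so
    that c and d are found by comparing two coefficients; the third one then
    agrees because p4 is on the conic. *)
Lemma quadrilateral_pencil p1 p2 p3 p4 :
    qform M p1 = 0 -> qform M p2 = 0 -> qform M p3 = 0 -> qform M p4 = 0 ->
    free [:: p1; p2] -> free [:: p1; p3] -> free [:: p2; p3] ->
    free [:: p1; p4] -> free [:: p2; p4] ->
  exists c d, forall x, det3 p1 p2 x * det3 p3 p4 x =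
    c * (det3 p1 p4 x * det3 p2 p3 x) + d * qform M x.
Proof.
move=> q1 q2 q3 q4 f12 f13 f23 f14 f24.
have D0 := conic_noncollinear q1 q2 q3 f12 f13 f23.
have w0 := conic_noncollinear q1 q2 q4 f12 f14 f24.
have b23 := M_nodegen f23 q2 q3.
have coord z : exists u v w, z = u *: p1 + v *: p2 + w *: p3.
  exists (det3 z p2 p3 / det3 p1 p2 p3), (det3 p1 z p3 / det3 p1 p2 p3),
    (det3 p1 p2 z / det3 p1 p2 p3).
  apply: (scalerI D0); rewrite cramer3 !scalerDr !scalerA.
  by rewrite !(mulrC (det3 p1 p2 p3)) !divfK.
have [u [v [w p4E]]] := coord p4.
have {}w0 : w != 0.
  apply: contraNneq w0 => w00; rewrite p4E w00 scale0r addr0.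
  by rewrite det3_combl.
have q4E : u * v * polar M p1 p2 + u * w * polar M p1 p3
    + v * w * polar M p2 p3 = 0.
  by have := q4; rewrite p4E qform3 q1 q2 q3 !mulr0 !add0r.
exists (u * polar M p1 p2 / (w * polar M p2 p3)),
  (det3 p1 p2 p3 ^+ 2 * u / polar M p2 p3) => x.
have [x1 [x2 [x3 xE]]] := coord x.
have e12 : det3 p1 p2 x = x3 * det3 p1 p2 p3 by rewrite xE /det3 !mxE; ring.
have e23 : det3 p2 p3 x = x1 * det3 p1 p2 p3 by rewrite xE /det3 !mxE; ring.
have e34 : det3 p3 p4 x = (u * x2 - v * x1) * det3 p1 p2 p3.
  by rewrite xE p4E /det3 !mxE; ring.
have e14 : det3 p1 p4 x = (v * x3 - w * x2) * det3 p1 p2 p3.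
  by rewrite xE p4E /det3 !mxE; ring.
rewrite e12 e23 e34 e14 [in qform M x]xE qform3 q1 q2 q3 !mulr0 !add0r.
(* The two sides differ by a multiple of the equation of the conic at p4. *)
rewrite -[RHS]subr0 -(mulr0 (det3 p1 p2 p3 ^+ 2 * (x1 * x3) /
  (w * polar M p2 p3))) -q4E.
by field; rewrite w0 b23.
Qed.

End Conic.

Section Morphism.
Variables (A B : comNzRingType) (f : {rmorphism A -> B}).

Lemma det3_map (x y z : 'rV_3) :
  det3 (map_mx f x) (map_mx f y) (map_mx f z) = f (det3 x y z).
Proof. by rewrite /det3 !mxE !(rmorphD, rmorphN, rmorphM). Qed.

Lemma qform_map (M : 'M_3) (x : 'rV_3) :
  qform (map_mx f M) (map_mx f x) = f (qform M x).
Proof.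
rewrite /qform rmorph_sum; apply: eq_bigr => i _.
by rewrite rmorph_sum; apply: eq_bigr => j _; rewrite !mxE !rmorphM.
Qed.

Lemma polar_map (M : 'M_3) (x y : 'rV_3) :
  polar (map_mx f M) (map_mx f x) (map_mx f y) = f (polar M x y).
Proof.
rewrite /polar rmorph_sum; apply: eq_bigr => i _.
by rewrite rmorph_sum; apply: eq_bigr => j _; rewrite !mxE rmorphM rmorphD !rmorphM.
Qed.

(** The shape of the second factor in qform_factor: it is linear in w.  For f the
    evaluation at the origin and w the vector of indeterminates, this shows that
    the factor is not a unit. *)
Lemma cofactor_eq0 (x y z w : 'rV[A]_3) a b c : map_mx f w = 0 ->
  f (det3 w y z * a + det3 x w z * b + det3 x y w * c) = 0.
Proof.
move=> w0; rewrite !rmorphD !rmorphM -!det3_map w0.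
by rewrite /det3 !mxE; ring.
Qed.

End Morphism.

(** * Irreducible conics contain no line *)

Section Irreducible.
Variables (F : fieldType) (q : {mpoly F[3]}).
Implicit Types (x y : 'rV[F]_3) (M : 'M[F]_3).

Let vars : 'rV[{mpoly F[3]}]_3 := \row_i 'X_i.

(** Quadratic forms are sums of monomials X_i X_j; any such decomposition
    provides a matrix, which need not be symmetric. *)
Lemma homog2_qform : q \is 2.-homog ->
  exists M, q = qform (map_mx (@mpolyC 3 F) M) vars.
Proof.
move=> /dhomogP q2; pose P (p : {mpoly F[3]}) :=
  exists M, p = qform (map_mx (@mpolyC 3 F) M) vars.
rewrite -/(P q) [q]mpolyE big_seq; apply: (big_ind P).
- exists 0; rewrite /qform big1 // => i _; rewrite big1 // => j _.
  by rewrite !mxE mpolyC0 mul0r.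
- move=> _ _ [M1 ->] [M2 ->]; exists (M1 + M2); rewrite /qform -big_split.
  apply: eq_bigr => i _; rewrite -big_split; apply: eq_bigr => j _.
  by rewrite !mxE mpolyCD mulrDl.
move=> m /q2 /= m2; have {}m2 : mdeg m = 2%N := m2.
have [i mi] : exists i, m i != 0%N.
  apply/existsP; rewrite -[[exists _, _]]negbK negb_exists.
  apply/negP => /forallP m0; move: m2; rewrite mdegE big1 // => i _.
  by have := m0 i; rewrite negbK => /eqP.
have mE : m = (U_(i) + (m - U_(i)))%MM by rewrite addmC submK // lep1mP.
have /mdeg1P[j /eqP mj] : mdeg (m - U_(i))%MM == 1%N.
  by move: m2; rewrite {1}mE mdegD mdeg1 => -[/eqP].
exists (q@_m *: delta_mx i j); rewrite /qform (bigD1 i) //= (bigD1 j) //=.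
rewrite [X in _ + X]big1 => [|i' ii'].
  rewrite big1 ?addr0 => [|j' jj']; rewrite !mxE !eqxx ?(negPf jj') ?andbF /=.
    by rewrite mulr1 mE mj mpolyXD mul_mpolyC.
  by rewrite mulr0 mpolyC0 mul0r.
by rewrite big1 // => j' _; rewrite !mxE (negPf ii') mulr0 mpolyC0 mul0r.
Qed.

Lemma meval_qform M x :
  (qform (map_mx (@mpolyC 3 F) M) vars).@[fun i => x 0 i] = qform M x.
Proof.
rewrite -(qform_map (meval (fun i => x 0 i))); congr qform; apply/matrixP => i j.
  by rewrite !mxE /= mevalC.
by rewrite !mxE /= mevalXU ord1.
Qed.

(** Otherwise q vanishes on the line through x and y, and qform_factor, applied to
    the vector of indeterminates, writes q as a product of two linear forms; these
    are not units, since they vanish at the origin. *)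
Lemma irreducible_conic_polar M x y : irreducible_conic q ->
    q = qform (map_mx (@mpolyC 3 F) M) vars -> free [:: x; y] ->
    qform M x = 0 -> qform M y = 0 -> polar M x y != 0.
Proof.
case=> q2 [q0 qN qI] qE fxy qx qy; apply/eqP => pxy.
have [z z0] := free2_det3 fxy.
pose c : {rmorphism F -> {mpoly F[3]}} := @mpolyC 3 F.
pose cx := map_mx c x; pose cy := map_mx c y.
pose cz := map_mx c z; pose cM := map_mx c M.
pose l := det3 cx cy vars.
pose m := det3 vars cy cz * polar cM cx cz + det3 cx vars cz * polar cM cy cz
  + l * qform cM cz.
have DqE : c (det3 x y z) ^+ 2 * q = l * m.
  rewrite [in LHS]qE -(det3_map c); apply: qform_factor.
  - by rewrite (qform_map c) qx rmorph0.
  - by rewrite (qform_map c) qy rmorph0.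
  - by rewrite (polar_map c) pxy rmorph0.
have cK : c (det3 x y z)^-1 ^+ 2 * c (det3 x y z) ^+ 2 = 1.
  by rewrite -exprMn -rmorphM mulVf // rmorph1 expr1n.
have ev0 (p : {mpoly F[3]}) : p.@[fun=> 0] = 0 -> p \isn't a GRing.unit.
  move=> p0; apply/negP => pu.
  have : p.@[fun=> 0] \is a GRing.unit by apply: (rmorph_unit (meval _)).
  by rewrite p0 unitr0.
pose ev : {rmorphism {mpoly F[3]} -> F} := meval (fun=> 0 : F).
have v0 : map_mx ev vars = 0 by apply/rowP => i; rewrite !mxE /ev /= mevalXU.
have l0 : ev l = 0 by rewrite -(det3_map ev) v0 /det3 !mxE; ring.
have m0 : ev m = 0 := cofactor_eq0 _ _ _ _ _ _ v0.
have [] := qI (c (det3 x y z)^-1 ^+ 2 * l) m.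
- by rewrite -mulrA -DqE mulrA cK mul1r.
- apply/negP/ev0; rewrite mevalM; apply/eqP.
  by rewrite mulf_eq0 orbC -[_.@[_]]/(ev l) l0 eqxx.
- by apply/negP/ev0.
Qed.

End Irreducible.

(** * Points of the plane and their coordinates *)

Section Points.
Variable F : fieldType.
Implicit Types (P Q : point F) (x y : 'rV[F]_3) (U : {vspace 'rV[F]_3}).

Definition coords P : 'rV[F]_3 := vpick (val P).

Lemma coords_neq0 P : coords P != 0.
Proof. by rewrite vpick0 -dimv_eq0 (eqP (valP P)). Qed.

Lemma val_coords P : val P = <[coords P]>%VS.
Proof.
apply/esym/eqP; rewrite eqEdim -memvE memv_pick dim_vline coords_neq0.
by rewrite (eqP (valP P)).
Qed.

Lemma incidentE P U : incident P U = (coords P \in U).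
Proof. by rewrite /incident val_coords -memvE. Qed.

Lemma eq_point P Q : (P == Q) = (coords P \in <[coords Q]>%VS).
Proof.
rewrite -val_eqE /= eqEdim (eqP (valP P)) (eqP (valP Q)) leqnn andbT.
by rewrite (val_coords P) (val_coords Q) -memvE.
Qed.

Lemma free_coords P Q : free [:: coords P; coords Q] = (P != Q).
Proof. by rewrite free_cons seq1_free span_seq1 coords_neq0 andbT eq_point. Qed.

Lemma dim2_span x y U : \dim U = 2%N -> free [:: x; y] -> x \in U -> y \in U ->
  U = (<[x]> + <[y]>)%VS.
Proof.
move=> dimU fxy Ux Uy; apply/esym/eqP.
rewrite eqEdim subv_add -!memvE Ux Uy dimU.
by rewrite -(span_seq1 y) -span_cons (eqP fxy).
Qed.

End Points.

(** * Forms of a given degree *)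

Section Forms.
Variable F : numFieldType.
Implicit Types (f g : 'rV[F]_3 -> F) (x y : 'rV[F]_3).

(** A stand-in for homogeneous polynomials: being polynomial on each affine line is
    all that counting zeros on a line requires. *)
Definition homform d f :=
  (forall c x, f (c *: x) = c ^+ d * f x) /\
  (forall x y, exists P : {poly F},
     (size P <= d.+1)%N /\ forall t, f (x + t *: y) = P.[t]).

Lemma horner_off0 (P : {poly F}) : (forall t, t != 0 -> P.[t] = 0) -> P = 0.
Proof.
move=> P0; apply/eqP/negPn/negP => Pn0.
have := @max_poly_roots _ P [seq n.+1%:R | n <- iota 0 (size P)] Pn0.
rewrite size_map size_iota ltnn => roots; suff: false by []; apply: roots.
  by apply/allP => _ /mapP[n _ ->]; rewrite /root P0 // pnatr_eq0.
rewrite map_inj_uniq ?iota_uniq // => n m /eqP.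
by rewrite eqr_nat => /eqP[].
Qed.

Lemma homform_det3 x y : homform 1 (det3 x y).
Proof.
split=> [c z|z w]; first by rewrite det3Z expr1.
exists ((det3 x y w)%:P * 'X + (det3 x y z)%:P); split=> [|t].
  by rewrite size_MXaddC; case: ifP => // _; rewrite ltnS size_polyC; case: eqP.
by rewrite det3_line hornerMXaddC hornerC addrC (mulrC t).
Qed.

Lemma homformZ d a f : homform d f -> homform d (fun x => a * f x).
Proof.
case=> fh fp; split=> [c x|x y]; first by rewrite fh mulrCA.
have [P [sP PE]] := fp x y; exists (a%:P * P); split=> [|t].
  by rewrite mul_polyC (leq_trans (size_scale_leq _ _)).
by rewrite PE !hornerE.
Qed.

Lemma homformD d f g : homform d f -> homform d g -> homform d (fun x => f x + g x).
Proof.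
case=> fh fp [gh gp]; split=> [c x|x y]; first by rewrite fh gh mulrDr.
have [P [sP PE]] := fp x y; have [Q [sQ QE]] := gp x y.
exists (P + Q); split=> [|t]; last by rewrite PE QE hornerD.
by rewrite (leq_trans (size_polyD _ _)) // geq_max sP.
Qed.

Lemma homformM d e f g :
  homform d f -> homform e g -> homform (d + e) (fun x => f x * g x).
Proof.
case=> fh fp [gh gp]; split=> [c x|x y]; first by rewrite fh gh exprD mulrACA.
have [P [sP PE]] := fp x y; have [Q [sQ QE]] := gp x y.
exists (P * Q); split=> [|t]; last by rewrite PE QE hornerM.
apply: leq_trans (size_polyMleq _ _) _.
by rewrite -subn1 leq_subLR; apply: leq_trans (leq_add sP sQ) _; rewrite addSn addnS.
Qed.

Lemma homform_const a : homform 0 (fun=> a).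
Proof.
split=> [c x|x y]; first by rewrite mul1r.
by exists a%:P; split=> [|t]; rewrite ?size_polyC_leq1 ?hornerC.
Qed.

Lemma homform_prod (I : Type) (r : seq I) (P : pred I) (f : I -> 'rV[F]_3 -> F) :
  (forall i, homform 1 (f i)) ->
  homform (count P r) (fun x => \prod_(i <- r | P i) f i x).
Proof.
move=> f1; elim: r => [|i r IHr].
  split=> [c x|x y]; first by rewrite !big_nil mul1r.
  by exists 1; split=> [|t]; rewrite ?size_poly1 ?big_nil ?hornerC.
have [fh fp] : homform (count P (i :: r))
    (fun x => (if P i then f i x else 1) * \prod_(j <- r | P j) f j x).
  apply: homformM IHr; case: (P i) => //; exact: homform_const.
split=> [c x|x y].
  by have := fh c x; rewrite !big_cons; case: (P i); rewrite ?mul1r.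
have [Q [sQ QE]] := fp x y; exists Q; split=> // t.
by rewrite -QE big_cons; case: (P i); rewrite ?mul1r.
Qed.

(** Continuity at t = 0, as polynomials in t that agree off 0 are equal. *)
Lemma homform_line_ext d e f g x y : homform d f -> homform e g ->
  (forall t, t != 0 -> f (x + t *: y) = g (x + t *: y)) -> f x = g x.
Proof.
move=> [_ /(_ x y)[P [_ PE]]] [_ /(_ x y)[Q [_ QE]]] fg.
rewrite -[x]addr0 -(scale0r y) PE QE; apply/eqP; rewrite -subr_eq0 -hornerN -hornerD.
rewrite (@horner_off0 (P - Q)) ?horner0 // => t t0.
by rewrite hornerD hornerN -PE -QE fg ?subrr.
Qed.

(** If x is none of the points of s, then x can serve as the point at infinity of
    the line: each point of s is w + t x for some t, where w is one of them, and f
    restricted to w + t x is a polynomial of degree at most d with more than d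
    roots.  Hence f vanishes on the line except possibly at x, and then also at
    x by homform_line_ext. *)
Lemma homform_vanish_on_line d f (U : {vspace 'rV[F]_3}) (s : seq (point F)) :
    homform d f -> \dim U = 2%N -> uniq s -> (d < size s)%N ->
    (forall P, P \in s -> incident P U) ->
    (forall P, P \in s -> f (coords P) = 0) ->
  forall x, x \in U -> x != 0 -> f x = 0.
Proof.
move=> [fh fp] dimU s_uniq ds sU s0 x Ux x0.
have [/hasP[P sP Px]|/hasPn sx] := boolP (has (fun P => coords P \in <[x]>%VS) s).
  have /vlineP[t PE] := Px; have := s0 _ sP; rewrite PE fh => /eqP.
  rewrite mulf_eq0 => /orP[/eqP t0|/eqP //].
  have : t != 0 by apply: contraNneq (coords_neq0 P) => tz; rewrite PE tz scale0r.
  by move=> /(expf_neq0 d); rewrite t0 eqxx.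
have [P0 sP0] : exists P0, P0 \in s.
  by case: (s) ds => // P0 s' _; exists P0; rewrite mem_head.
have fw : free [:: coords P0; x] by rewrite free_cons seq1_free span_seq1 sx.
set w := coords P0 in fw.
have UE : U = (<[w]> + <[x]>)%VS.
  by apply: dim2_span => //; rewrite -incidentE sU.
have [t tP] : exists t : 'I_(size s) -> F,
    forall i : 'I_(size s), coords (nth P0 s i) \in <[w + t i *: x]>%VS.
  apply: (@fin_all_exists _ _
    (fun i ti => coords (nth P0 s (val i)) \in <[w + ti *: x]>%VS)) => i.
  have sPi : nth P0 s i \in s by rewrite mem_nth.
  have := sU _ sPi; rewrite incidentE UE.
  move=> /memv_addP[_ /vlineP[a ->] [_ /vlineP[b ->] PE]].
  have a0 : a != 0.
    apply: contraNneq (sx _ sPi) => a0; rewrite PE a0 scale0r add0r.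
    by rewrite memvZ ?memv_line.
  exists (b / a); apply/vlineP; exists a.
  by rewrite PE scalerDr scalerA mulrC divfK.
have tN0 (i : 'I_(size s)) : w + t i *: x != 0.
  apply: contraNneq (coords_neq0 (nth P0 s i)) => wt0.
  by have := tP i; rewrite wt0 => /vlineP[c ->]; rewrite scaler0.
have t_inj : injective t.
  move=> i j tij; apply/val_inj/eqP; rewrite -(nth_uniq P0 (ltn_ord i) (ltn_ord j)) //.
  rewrite eq_point; have := tP i; rewrite tij => /vlineP[c ->].
  have /vlineP[e eE] := tP j; apply/memvZ/vlineP; exists e^-1.
  rewrite eE scalerA mulVf ?scale1r //.
  by apply: contraNneq (coords_neq0 (nth P0 s j)) => e0; rewrite eE e0 scale0r.
have {}t0 (i : 'I_(size s)) : f (w + t i *: x) = 0.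
  have /vlineP[c cE] := tP i; have := s0 (nth P0 s i) (mem_nth _ (ltn_ord i)).
  rewrite cE fh => /eqP; rewrite mulf_eq0 => /orP[/eqP c0|/eqP //].
  have : c != 0.
    by apply: contraNneq (coords_neq0 (nth P0 s i)) => cz; rewrite cE cz scale0r.
  by move=> /(expf_neq0 d); rewrite c0 eqxx.
have fwx u : f (w + u *: x) = 0.
  have [Q [sQ QE]] := fp w x; rewrite QE.
  have [->|Q0] := eqVneq Q 0; first exact: horner0.
  suff : (size s < size Q)%N by rewrite ltnNge (leq_trans sQ ds).
  rewrite -[size s]card_ord cardE -(size_map t); apply: max_poly_roots => //.
    by apply/allP => _ /mapP[i _ ->]; rewrite /root -QE t0.
  by rewrite map_inj_uniq ?enum_uniq.
apply: (homform_line_ext (conj fh fp) (homform_const 0) (y := w)) => u u0.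
have -> : x + u *: w = u *: (w + u^-1 *: x).
  by rewrite scalerDr scalerA divff // scale1r addrC.
by rewrite fh fwx mulr0.
Qed.

(** * The pencil of the red and the blue lines *)

Section Pencil.
Variable M : 'M[F]_3.
Hypothesis M_nodegen : forall x y, free [:: x; y] ->
  qform M x = 0 -> qform M y = 0 -> polar M x y != 0.

(** Induction on the polygon p 0, ..., p (2m+3), with its closing edge kept apart.
    The next polygon replaces the closing edge from p (2m+3) to p 0 by the three
    edges through p (2m+4) and p (2m+5); on the conic, the product of the two new
    blue lines is a multiple of the product of the old closing edge and the new
    red line. *)
Lemma polygon_pencil (p : nat -> 'rV[F]_3) m :
    (forall i, (i < m.*2.+4)%N -> qform M (p i) = 0) ->
    (forall i j, (i < j)%N -> (j < m.*2.+4)%N -> free [:: p i; p j]) ->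
  exists c C, homform m C /\ forall x,
    (\prod_(i < m.+1) det3 (p i.*2.+1) (p i.*2.+2) x)
      * det3 (p m.*2.+3) (p 0%N) x =
    c * \prod_(i < m.+2) det3 (p i.*2) (p i.*2.+1) x + qform M x * C x.
Proof.
elim: m => [|m IHm] qp fp.
  have f0 i : (0 < i)%N -> (i < 4)%N -> free [:: p i; p 0%N].
    by move=> i0 i4; rewrite free2C fp.
  have [c [d cd]] := quadrilateral_pencil M_nodegen (qp 1%N isT) (qp 2%N isT)
    (qp 3%N isT) (qp 0%N isT) (fp 1%N 2%N isT isT) (fp 1%N 3%N isT isT)
    (fp 2%N 3%N isT isT) (f0 1%N isT isT) (f0 2%N isT isT).
  exists (- c), (fun=> d); split; first exact: homform_const.
  move=> x; rewrite !big_ord_recl !big_ord0 !mulr1 /= cd.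
  by rewrite (det3_swap (p 0%N)); ring.
rewrite doubleS in qp fp.
have [| |c0 [C [fC CE]]] := IHm.
- by move=> i lti; apply: qp; rewrite ltnW // ltnW.
- by move=> i j ij ltj; apply: fp ij _; rewrite ltnW // ltnW.
have le i : (i <= 3)%N -> (m.*2.+2 + i < m.*2.+2.+4)%N.
  by move=> i3; rewrite -addn4 ltn_add2l.
have f0 i : (i <= 3)%N -> free [:: p (m.*2.+2 + i)%N; p 0%N].
  by move=> i3; rewrite free2C fp ?le.
have ff i j : (i < j)%N -> (j <= 3)%N ->
    free [:: p (m.*2.+2 + i)%N; p (m.*2.+2 + j)%N].
  by move=> ij j3; rewrite fp ?le ?ltn_add2l.
have [c [d]] := quadrilateral_pencil M_nodegen (qp _ (le 1%N isT))
  (qp _ (le 2%N isT)) (qp _ (le 3%N isT)) (qp 0%N isT)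
  (ff 1%N 2%N isT isT) (ff 1%N 3%N isT isT) (ff 2%N 3%N isT isT)
  (f0 1%N isT) (f0 2%N isT).
rewrite !addnS !addn0 => cd.
set L := det3 (p m.*2.+4) (p m.*2.+4.+1).
exists (c * c0), (fun x => c * (C x * L x) + d *
    \prod_(i < m.+1) det3 (p i.*2.+1) (p i.*2.+2) x); split.
  apply: homformD; apply: homformZ.
    by rewrite -addn1; apply: homformM => //; apply: homform_det3.
  have := homform_prod (index_enum 'I_m.+1) predT
    (fun i : 'I_m.+1 => homform_det3 (p i.*2.+1) (p i.*2.+2)).
  by rewrite count_predT -[index_enum _]enumT size_enum_ord.
move=> x; rewrite big_ord_recr /= -mulrA doubleS cd.
rewrite [X in c * c0 * X]big_ord_recr /= !doubleS -/(L x).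
have {}CE := CE x; set B := \prod_(i < _) _ in CE *; set R := \prod_(i < _) _ in CE *.
have -> : B * (c * (det3 (p m.*2.+3) (p 0%N) x * L x) + d * qform M x) =
  c * (B * det3 (p m.*2.+3) (p 0%N) x) * L x + B * d * qform M x by ring.
by rewrite CE; ring.
Qed.

Lemma red_blue_pencil (p : nat -> 'rV[F]_3) k : (1 < k)%N -> p (2 * k)%N = p 0%N ->
    (forall i, qform M (p i) = 0) ->
    (forall i j, (i < j)%N -> (j < 2 * k)%N -> free [:: p i; p j]) ->
  exists c C, homform (k - 2) C /\ forall x,
    \prod_(i < k) det3 (p i.*2.+1) (p i.*2.+2) x =
    c * \prod_(i < k) det3 (p i.*2) (p i.*2.+1) x + qform M x * C x.
Proof.
case: k => [|[|m]] // _ pE qp fp; rewrite mul2n in pE fp.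
have [|c [C [fC CE]]] := @polygon_pencil p m (fun i _ => qp i); first exact: fp.
exists c, C; rewrite subn2; split=> // x.
by rewrite big_ord_recr /= -CE -[_.*2.+4]/(m.+2.*2) pE.
Qed.

End Pencil.
End Forms.

(** * Polygons inscribed in a conic *)

Section Polygon.
Variables (F : numFieldType) (M : 'M[F]_3) (k : nat) (v : 'I_(2 * k) -> point F).
Hypothesis M_nodegen : forall x y, free [:: x; y] ->
  qform M x = 0 -> qform M y = 0 -> polar M x y != 0.
Hypothesis k_gt1 : (1 < k)%N.
Hypothesis v_inj : injective v.
Hypothesis v_conic : forall i, qform M (coords (v i)) = 0.
Implicit Types (P Q : point F).

Let n_gt0 : (0 < 2 * k)%N. Proof. by rewrite muln_gt0 (ltnW k_gt1). Qed.

(** Indexing the vertices by nat, modulo 2k, makes the successor of an index and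
    the wrap-around of the closing edge transparent to arithmetic. *)
Definition vertex i : point F := v (Ordinal (ltn_pmod i n_gt0)).
Definition on_edge i P : bool :=
  det3 (coords (vertex i)) (coords (vertex i.+1)) (coords P) == 0.

Lemma vertex_ord (i : 'I_(2 * k)) : vertex i = v i.
Proof. by congr v; apply: val_inj; rewrite /= modn_small. Qed.

Lemma eq_vertex i j : (vertex i == vertex j) = (i == j %[mod 2 * k]).
Proof. by rewrite (inj_eq v_inj) -val_eqE. Qed.

Lemma vertex_conic i : qform M (coords (vertex i)) = 0.
Proof. exact: v_conic. Qed.

Lemma neq_mod i d : (0 < d < 2 * k)%N -> i != i + d %[mod 2 * k].
Proof.
case/andP=> d0 dk; have := eqn_modDl i 0 d (2 * k); rewrite addn0 => ->.
by rewrite mod0n modn_small // eq_sym -lt0n.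
Qed.

Lemma free_edge i : free [:: coords (vertex i); coords (vertex i.+1)].
Proof. by rewrite free_coords eq_vertex -(addn1 i) neq_mod //; lia. Qed.

Lemma edge_lineE (i : 'I_(2 * k)) P : incident P (edge_line v i) = on_edge i P.
Proof.
rewrite incidentE /on_edge det3_mem ?free_edge // /edge_line !val_coords vertex_ord.
by congr (_ \in (_ + <[coords (v _)]>)%VS); apply: val_inj.
Qed.

Lemma on_edge_mod i j P : i = j %[mod 2 * k] -> on_edge i P = on_edge j P.
Proof.
move=> ij; rewrite /on_edge; have /eqP-> : vertex i == vertex j by rewrite eq_vertex ij.
suff /eqP-> : vertex i.+1 == vertex j.+1 by [].
by rewrite eq_vertex -(addn1 i) -(addn1 j) eqn_modDr ij.
Qed.

Lemma conic_edge i P : on_edge i P -> qform M (coords P) = 0 ->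
  P = vertex i \/ P = vertex i.+1.
Proof.
move=> /eqP iP qP.
have [] := conic_secant M_nodegen (vertex_conic i) (vertex_conic i.+1)
  (free_edge i) qP iP; rewrite -eq_point => /eqP; by [left | right].
Qed.

Lemma vertex_on_edge i j : on_edge i (vertex j) =
  (j == i %[mod 2 * k]) || (j == i.+1 %[mod 2 * k]).
Proof.
rewrite -!eq_vertex.
apply/idP/orP => [/conic_edge[]|[]/eqP->]; rewrite ?vertex_conic //.
- by move=> ->; left.
- by move=> ->; right.
- by rewrite /on_edge /det3; apply/eqP; ring.
- by rewrite /on_edge /det3; apply/eqP; ring.
Qed.

Lemma consecutive_edges i P : on_edge i P -> on_edge i.+1 P -> P = vertex i.+1.
Proof.
move=> /eqP iP /eqP jP; apply/eqP; rewrite eq_point.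
have D0 : det3 (coords (vertex i)) (coords (vertex i.+1)) (coords (vertex i.+2)) != 0.
  rewrite -[_ == 0]/(on_edge i (vertex i.+2)) vertex_on_edge negb_or.
  rewrite eq_sym (eq_sym (_ %% _)%N (i.+1 %% _)%N) -(addn2 i) neq_mod; last by lia.
  by rewrite addn2 -(addn1 i.+1) neq_mod; last by lia.
apply/vlineP; exists (det3 (coords (vertex i)) (coords P) (coords (vertex i.+2)) /
  det3 (coords (vertex i)) (coords (vertex i.+1)) (coords (vertex i.+2))).
apply: (scalerI D0); rewrite cramer3 iP -[det3 (coords P) _ _]det3_rot jP.
by rewrite !scale0r add0r addr0 scalerA mulrC divfK.
Qed.

(** Two common points would make both edge lines equal to the line through them,
    and vertex j would then lie on edge i. *)
Lemma edges_meet_once i j P Q : ~~ on_edge i (vertex j) ->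
  on_edge i P -> on_edge j P -> on_edge i Q -> on_edge j Q -> P = Q.
Proof.
move=> ij iP jP iQ jQ; apply/eqP; apply: contraNT ij => PQ.
have lineE l : on_edge l P -> on_edge l Q ->
    (<[coords (vertex l)]> + <[coords (vertex l.+1)]>
      = <[coords P]> + <[coords Q]>)%VS.
  rewrite /on_edge !det3_mem ?free_edge // => lP lQ.
  apply: dim2_span; rewrite ?free_coords //.
  by rewrite -(span_seq1 (coords (vertex l.+1))) -span_cons (eqP (free_edge l)).
rewrite /on_edge det3_mem ?free_edge // (lineE i) // -(lineE j) //.
by rewrite memvE addvSl.
Qed.

Lemma red_blueP P : red_blue_point v P <->
  (exists a b : 'I_k, on_edge a.*2 P /\ on_edge b.*2.+1 P) /\ forall i, P <> v i.
Proof.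
split=> -[[i [j H]] nv]; split=> //.
  case: H; rewrite /red /blue !edge_lineE => i_even j_odd iP jP.
  have ik : (i./2 < k)%N by rewrite ltn_half_double -mul2n.
  have jk : (j./2 < k)%N by rewrite ltn_half_double -mul2n.
  exists (Ordinal ik), (Ordinal jk); split=> /=.
    by rewrite -[i./2.*2]/(false + i./2.*2)%N -(negPf i_even) odd_double_half.
  by rewrite -[_.+1]/(true + j./2.*2)%N -{1}j_odd odd_double_half.
have ik : (i.*2 < 2 * k)%N by rewrite mul2n ltn_double.
have jk : (j.*2.+1 < 2 * k)%N by rewrite mul2n ltn_Sdouble.
case: H => iP jP; exists (Ordinal ik), (Ordinal jk).
by rewrite !edge_lineE /red /blue /= !odd_double.
Qed.

(** * The grid of red-blue intersections *)

Definition red_line (a : 'I_k) P := on_edge a.*2 P.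
Definition blue_line (b : 'I_k) P := on_edge b.*2.+1 P.

(** Pairs of a red and a blue line that are not consecutive edges: the blue lines
    a and a - 1 are the neighbours of the red line a. *)
Definition opposite_pairs : {set 'I_k * 'I_k} :=
  [set t | t.2 \in ~: [set t.1; ord_pred t.1]].

Lemma card_opposite_pairs : #|opposite_pairs| = (k ^ 2 - 2 * k)%N.
Proof.
rewrite -sum1_card.
rewrite (eq_bigl (fun t => xpredT t.1 && (t.2 \in ~: [set t.1; ord_pred t.1])));
  last by move=> t; rewrite inE.
rewrite -(pair_big_dep xpredT (fun a b => b \in ~: [set a; ord_pred a])
  (fun _ _ => 1%N)) /=.
rewrite (eq_bigr (fun=> (k - 2)%N)) => [|a _].
  by rewrite sum_nat_const card_ord; nia.
rewrite sum1_card cardsCs setCK card_ord cards2.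
suff -> : a != ord_pred a by [].
rewrite -val_eqE /=; have := ltn_ord a; case: (val a) => [|a'] ak.
  by rewrite add0n modn_small; lia.
by rewrite addSn /= addnC modnDl modn_small; lia.
Qed.

Lemma opposite_pairsP a b P : (forall i, P <> v i) ->
  red_line a P -> blue_line b P -> (a, b) \in opposite_pairs.
Proof.
move=> nv aP bP; rewrite !inE /= negb_or; apply/andP; split.
  by apply/eqP => ba; apply: (nv _ (consecutive_edges aP _)); rewrite -ba.
apply/eqP => ba; apply: (nv _ (consecutive_edges bP _)).
move: aP; rewrite /red_line (on_edge_mod (j := b.*2.+2)) // -[b.*2.+2]/(b.+1.*2).
have -> : (a : nat) = (b.+1 %% k)%N by rewrite ba -[LHS]/(val _) -{1}[a]ord_predK.
by rewrite -!muln2 muln_modl (mulnC k 2%N) modn_mod.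
Qed.

(** Sending a point of G to a pair of lines through it is injective into
    opposite_pairs.  Both sides have k^2 - 2k elements, so that each opposite pair
    comes from a point of G.  A point on two red lines and one blue line would come
    from two pairs. *)
Lemma red_blue_simple (G : seq (point F)) (P : point F) (a a' b : 'I_k) :
    (forall Q, Q \in G <-> red_blue_point v Q) -> uniq G ->
    size G = (k ^ 2 - 2 * k)%N -> P \in G ->
  red_line a P -> red_line a' P -> blue_line b P -> a = a'.
Proof.
move=> hG uG sG PG aP a'P bP.
have nv Q : Q \in G -> forall i, Q <> v i by move=> /hG[].
pose pairs Q := [pred t : 'I_k * 'I_k | red_line t.1 Q && blue_line t.2 Q].
pose g Q := [pick t | pairs Q t].
have gP Q t : g Q = Some t -> red_line t.1 Q /\ blue_line t.2 Q.
  by rewrite /g; case: pickP => // u /andP[uR uB] [<-].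
have meet t Q Q' : t \in opposite_pairs -> red_line t.1 Q -> blue_line t.2 Q ->
    red_line t.1 Q' -> blue_line t.2 Q' -> Q = Q'.
  move=> tO rQ bQ rQ' bQ'; apply: edges_meet_once rQ bQ rQ' bQ'.
  have t1k := ltn_ord t.1; have t2k := ltn_ord t.2.
  rewrite vertex_on_edge !(modn_small (d := 2 * k)); try lia.
  move: tO; rewrite !inE negb_or -!val_eqE /= => /andP[+ _]; lia.
have gG Q : Q \in G -> exists2 t, g Q = Some t & t \in opposite_pairs.
  move=> QG; have /hG/red_blueP[[c [d [cQ dQ]]] _] := QG.
  rewrite /g; case: pickP => [t /andP[tR tB]|/(_ (c, d))]; last first.
    by rewrite /= /red_line cQ /blue_line dQ.
  by exists t; rewrite // [t]surjective_pairing (opposite_pairsP (nv _ QG)).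
have [_ gE] : (size (map g G) = size (map Some (enum opposite_pairs))) *
    (map g G =i map Some (enum opposite_pairs)).
  apply: uniq_min_size.
  - rewrite map_inj_in_uniq // => Q Q' /gG[t gQ tO] /gG[t' gQ' _] QQ'.
    have [tt'] : Some t = Some t' by rewrite -gQ QQ'.
    have [rQ bQ] := gP _ _ gQ; have [rQ' bQ'] := gP _ _ gQ'.
    by apply: (meet t); rewrite ?tt' // -tt'.
  - move=> _ /mapP[Q /gG[t gQ tO] ->].
    by rewrite gQ map_f // mem_enum.
  - by rewrite !size_map -cardE card_opposite_pairs sG.
have pairE c : red_line c P -> g P = Some (c, b).
  move=> cP; have cbO := opposite_pairsP (nv _ PG) cP bP.
  have : Some (c, b) \in map g G by rewrite gE map_f // mem_enum.
  case/mapP=> Q QG gQ; have [cQ bQ] := gP _ _ (esym gQ).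
  by rewrite (meet _ _ _ cbO cP bP cQ bQ).
by have := pairE _ aP; rewrite (pairE _ a'P) => -[].
Qed.

(** * Zeros of the cofactor C *)

Variables (c : F) (C : 'rV[F]_3 -> F).
Hypothesis C_form : homform (k - 2)%N C.
Hypothesis pencil : forall x,
  \prod_(b < k) det3 (coords (vertex b.*2.+1)) (coords (vertex b.*2.+2)) x =
  c * \prod_(a < k) det3 (coords (vertex a.*2)) (coords (vertex a.*2.+1)) x
  + qform M x * C x.

Lemma red_lineE (a : 'I_k) m : (m < 2 * k)%N ->
  red_line a (vertex m) = (m == a.*2) || (m == a.*2.+1).
Proof.
move=> mk; have ak := ltn_ord a.
by rewrite /red_line vertex_on_edge !(modn_small (d := 2 * k)); try lia.
Qed.

Lemma blue_lineE (b : 'I_k) m : (m < 2 * k)%N ->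
  blue_line b (vertex m) = (m == b.*2.+1) || (m == if b.+1 == k then 0%N else b.*2.+2).
Proof.
move=> mk; have bk := ltn_ord b; rewrite /blue_line vertex_on_edge.
rewrite (modn_small mk) (modn_small (_ : b.*2.+1 < 2 * k)%N); last lia.
have [bE|bN] := eqVneq b.+1 k; last first.
  by rewrite (modn_small (_ : b.*2.+2 < 2 * k)%N) //; lia.
by rewrite (_ : b.*2.+2 = 2 * k)%N ?modnn //; lia.
Qed.

(** Let y be the other vertex on the red line a through the vertex x, and let b be
    the blue line through x.  At x + t y the form of a vanishes, that of b is t
    times its value at y, and Q is t times the polar form.  Dividing by t and
    letting t tend to 0 leaves a nonzero product of blue forms on one side and a
    multiple of C x on the other. *)
Lemma pencil_off_vertices i : C (coords (vertex i)) != 0.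
Proof.
have [a [b [j [aij bj ib ib']]]] : exists (a b : 'I_k) j,
    [/\ red_line a (vertex i) && red_line a (vertex j), ~~ blue_line b (vertex j),
        blue_line b (vertex i)
      & forall b', blue_line b' (vertex i) -> b' = b].
  have {1 2 3}-> : vertex i = vertex (i %% (2 * k)).
    by apply/eqP; rewrite eq_vertex modn_mod.
  set m := (i %% _)%N; have mk : (m < 2 * k)%N by rewrite ltn_mod.
  have ak : (m./2 < k)%N by lia.
  pose a := Ordinal ak.
  have [m_odd|m_even] := boolP (odd m).
    exists a, a, a.*2; rewrite !red_lineE ?blue_lineE //=; try lia.
    split; [lia | by case: ifP => ?; lia | lia |].
    move=> b'; have b'k := ltn_ord b'; rewrite blue_lineE // => b'm.
    by apply/val_inj; move: b'm; case: ifP => ? /=; lia.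
  (* The blue line before the red line m / 2, cyclically. *)
  have bk : ((if m == 0 then k else m./2).-1 < k)%N by case: ifP => ?; lia.
  exists a, (Ordinal bk), a.*2.+1; rewrite !red_lineE ?blue_lineE //=; try lia.
  split; [lia | by do 2 case: ifP => ?; lia | by do 2 case: ifP => ?; lia |].
  move=> b'; have b'k := ltn_ord b'; rewrite blue_lineE // => b'm.
  by apply/val_inj; move: b'm => /=; do 2 case: ifP => ?; lia.
have [/eqP ai /eqP aj] := andP aij.
set x := coords (vertex i) in ai ib ib' *; set y := coords (vertex j) in bj aj.
pose blue_form (l : 'I_k) := det3 (coords (vertex l.*2.+1)) (coords (vertex l.*2.+2)).
have bx : blue_form b x = 0 by apply/eqP.
have fg t : t != 0 ->
    blue_form b y * \prod_(l < k | l != b) blue_form l (x + t *: y)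
    = polar M x y * C (x + t *: y).
  move=> t0; have := pencil (x + t *: y).
  have bt : det3 (coords (vertex b.*2.+1)) (coords (vertex b.*2.+2)) (x + t *: y)
      = t * blue_form b y by rewrite det3_line [X in X + _]bx add0r.
  have at0 : det3 (coords (vertex a.*2)) (coords (vertex a.*2.+1)) (x + t *: y) = 0.
    by rewrite det3_line ai aj mulr0 addr0.
  rewrite (bigD1 b) //= bt [in X in _ = X](bigD1 a) //= at0 mul0r mulr0 add0r.
  rewrite qform_line !vertex_conic mulr0 addr0 add0r -!mulrA.
  exact: mulfI.
apply/eqP => Cx.
have f1 l : homform 1 (blue_form l) by apply: homform_det3.
have := homform_line_ext (homformZ (blue_form b y)
    (homform_prod (index_enum _) (fun l => l != b) f1))
  (homformZ (polar M x y) C_form) fg.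
rewrite Cx mulr0 => /eqP; rewrite mulf_eq0 (negPf (bj : blue_form b y != 0)) /=.
move=> /prodf_eq0[l lb /ib' lE].
by rewrite lE eqxx in lb.
Qed.

Lemma pencil_red_blue P : red_blue_point v P -> C (coords P) = 0.
Proof.
move=> /red_blueP[[a [b [/eqP aP /eqP bP]]] nv].
have := pencil (coords P).
rewrite (bigD1 b) //= bP mul0r (bigD1 a) //= aP mul0r mulr0 add0r => /esym/eqP.
rewrite mulf_eq0 => /orP[/eqP qP|/eqP //].
by have [] := @conic_edge a.*2 P _ qP; rewrite ?/on_edge ?aP // => /nv.
Qed.

(** C vanishes on the green line, so each red line meets it in a point of G.  If
    these points all were in s, which has k - 1 elements, two of the k red lines
    would share one of them, against red_blue_simple. *)
Lemma green_line_extra (G s : seq (point F)) (green : line F) :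
    (forall Q, Q \in G <-> red_blue_point v Q) -> uniq G ->
    size G = (k ^ 2 - 2 * k)%N -> uniq s -> size s = (k - 1)%N ->
    (forall P, P \in s -> P \in G) -> (forall P, P \in s -> incident P (val green)) ->
  exists P, [/\ P \in G, P \notin s & incident P (val green)].
Proof.
move=> hG uG sG us ss s_sub s_green.
have C0 := homform_vanish_on_line C_form (eqP (valP green)) us.
have {}C0 P : incident P (val green) -> C (coords P) = 0.
  rewrite incidentE => Pg; apply: C0 => // [|Q /s_sub/hG|]; first by rewrite ss; lia.
    exact: pencil_red_blue.
  exact: coords_neq0.
(* Two planes of a space of dimension 3 have a nonzero common vector. *)
have red_green (a : 'I_k) : exists P, incident P (val green) /\ red_line a P.
  pose E := (<[coords (vertex a.*2)]> + <[coords (vertex a.*2.+1)]>)%VS.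
  have dimE : \dim E = 2%N.
    by rewrite /E -(span_seq1 (coords (vertex a.*2.+1))) -span_cons (eqP (free_edge _)).
  have UE0 : vpick (val green :&: E)%VS != 0.
    rewrite vpick0 -dimv_eq0; have := dimv_sum_cap (val green) E.
    rewrite dimE (eqP (valP green)).
    have := dimvS (subvf (val green + E)%VS); rewrite dimvf /dim /=; lia.
  have dim1 : \dim <[vpick (val green :&: E)%VS]> == 1%N by rewrite dim_vline UE0.
  pose P : point F := exist (fun U : {vspace _} => \dim U == 1%N) _ dim1; exists P.
  have : coords P \in (val green :&: E)%VS.
    have : coords P \in val P by apply: memv_pick.
    by move=> /vlineP[t ->]; rewrite memvZ ?memv_pick.
  rewrite memv_cap => /andP[PU PE].
  by rewrite incidentE /red_line /on_edge det3_mem ?free_edge.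
have all_G a P : incident P (val green) -> red_line a P ->
    (exists b, blue_line b P) /\ P \in G.
  move=> Pg aP; have := pencil (coords P).
  rewrite [in RHS](bigD1 a) //= (eqP aP) mul0r mulr0 (C0 _ Pg) mulr0 addr0.
  move=> /eqP/prodf_eq0[b _ bP]; split; first by exists b.
  apply/hG/red_blueP; split; first by exists a, b.
  move=> i Pi; have := pencil_off_vertices i.
  by rewrite vertex_ord -Pi C0 ?eqxx.
have [/hasP[P PG /andP[Ps Pg]]|/hasPn Gs] :=
  boolP (has (fun P => (P \notin s) && incident P (val green)) G).
  by exists P.
have [f fP] := @fin_all_exists _ _ (fun a P => incident P (val green) /\ red_line a P)
  red_green.
have f_inj : injective f.
  move=> a a' faa'; have [fg fa] := fP a; have [_ fa'] := fP a'.
  have [[b bP] fG] := all_G _ _ fg fa; rewrite -faa' in fa'.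
  exact: red_blue_simple hG uG sG fG fa fa' bP.
have : (size (map f (enum 'I_k)) <= size s)%N.
  apply: uniq_leq_size; first by rewrite map_inj_uniq ?enum_uniq.
  move=> _ /mapP[a _ ->]; have [fg fa] := fP a; have [_ fG] := all_G _ _ fg fa.
  by have := Gs _ fG; rewrite fg andbT negbK.
by rewrite size_map size_enum_ord ss; lia.
Qed.

End Polygon.

Theorem theorem9 (R : realType) (k : nat) (hk : (2 <= k)%N)
    (q : {mpoly R[i][3]}) (hq : irreducible_conic q)
    (v : 'I_(2 * k) -> point R[i]) (hv : inscribed_polygon q v)
    (G : seq (point R[i]))
    (hG : forall P : point R[i], P \in G <-> red_blue_point v P)
    (G_distinct : uniq G) (G_size : size G = (k ^ 2 - 2 * k)%N)
    (green : line R[i]) (s : seq (point R[i]))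
    (s_distinct : uniq s) (s_size : size s = (k - 1)%N)
    (s_sub : forall P : point R[i], P \in s -> P \in G)
    (s_green : forall P : point R[i], P \in s -> incident P (val green)) :
  exists P : point R[i], [/\ P \in G, P \notin s & incident P (val green)].
Proof.
have [M qE] := homog2_qform hq.1.
have M_nodegen x y : free [:: x; y] ->
    qform M x = 0 -> qform M y = 0 -> polar M x y != 0.
  exact: irreducible_conic_polar hq qE.
have [v_inj v_q] := hv.
have v_conic i : qform M (coords (v i)) = 0.
  by rewrite -meval_qform -qE; apply: v_q; apply: memv_pick.
pose p i := coords (vertex v hk i).
have [|||c [C [C_form pencil]]] := @red_blue_pencil _ M M_nodegen p k hk.
- by congr coords; apply/eqP; rewrite eq_vertex // modnn mod0n.
- by move=> i; apply: vertex_conic.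
- move=> i j ij jk; rewrite free_coords eq_vertex // !modn_small ?neq_ltn ?ij //.
  exact: ltn_trans ij jk.
exact: (green_line_extra M_nodegen v_inj v_conic C_form pencil hG G_distinct G_size
  s_distinct s_size s_sub s_green).
Qed.
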